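(* Let $\xi\in(0,1)$, let $\mathbf{P}_0\in\mathbb{R}^{S\times S}$ be positive definite, and let $\{\widetilde{\mathbf{P}}_k\}_{k\ge0}$ be defined by $\widetilde{\mathbf{P}}_{k+1}=\widetilde{\mathbf{P}}_k+\xi f(\widetilde{\mathbf{P}}_k)$, $\widetilde{\mathbf{P}}_0=\mathbf{P}_0$. Let $t_k=k\xi$ for $k\ge0$, and define the continuous, piecewise linear matrix-valued function $\overline{\mathbf{P}}(t)$, $t\ge0$, by $\overline{\mathbf{P}}(t_k)=\widetilde{\mathbf{P}}_k$ with linear interpolation on each interval $[t_k,t_{k+1}]$: $$\overline{\mathbf{P}}(t)=\widetilde{\mathbf{P}}_k+\xi^{-1}(t-t_k)(\widetilde{\mathbf{P}}_{k+1}-\widetilde{\mathbf{P}}_k).$$ For $l\in\mathbb{R}_+$ let $\mathbf{P}^l(t)$, $t\ge l$, denote the trajectory of the ODE $\dot{\mathbf{P}}(t)=f(\mathbf{P}(t))$ with initial condition $\mathbf{P}^l(l)=\overline{\mathbf{P}}(l)$. Then, for any $l>0$ and $L>0$, $$\sup_{t\in[0,L]}\big\|\overline{\mathbf{P}}(l+t)-\mathbf{P}^l(l+t)\big\|=\mathcal{O}(\xi).$$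
   Context: $f(\mathbf{P})=\mathbf{A}^T\mathbf{P}\mathbf{A}-\mathbb{E}\big[\delta_k\mathbf{A}^T\mathbf{P}\mathbf{B}\mathbf{H}_k(\delta_k\mathbf{H}_k^T\mathbf{B}^T\mathbf{P}\mathbf{B}\mathbf{H}_k+\delta_k\mathbf{H}_k^T\mathbf{M}\mathbf{H}_k+\mathbf{R})^{-1}\mathbf{H}_k^T\mathbf{B}^T\mathbf{P}\mathbf{A}\big]-\mathbf{P}+\mathbf{Q}$, where $\mathbf{A}\in\mathbb{R}^{S\times S}$, $\mathbf{B}\in\mathbb{R}^{S\times N_r}$; $\mathbf{Q}\in\mathbb{R}^{S\times S}$, $\mathbf{R}\in\mathbb{R}^{N_t\times N_t}$, $\mathbf{M}\in\mathbb{R}^{N_r\times N_r}$ are positive definite; $\mathbf{H}_k\in\mathbb{R}^{N_r\times N_t}$ has i.i.d. $\mathcal N(0,1)$ entries; $\delta_k\in\{0,1\}$ is a random variable independent of $\mathbf{H}_k$, $(\delta_k,\mathbf{H}_k)$ being i.i.d. over $k$. $\|\cdot\|$ is the spectral norm; $\mathcal O(\xi)$ is with respect to $\xi\to0$, with $l$ and $L$ fixed. *)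

(* Defs.v *)
From HB Require Import structures.
From mathcomp Require Import all_boot all_order all_algebra finmap.
From mathcomp Require Import all_classical all_reals all_analysis.

Set Implicit Arguments.
Unset Strict Implicit.
Unset Printing Implicit Defensive.

Import Order.TTheory GRing.Theory Num.Theory.
Import numFieldNormedType.Exports.

Local Open Scope classical_set_scope.
Local Open Scope ring_scope.

Section matrices.
Context {R : realType}.

Definition posdefmx n (M : 'M[R]_n) : Prop :=
  M^T = M /\ forall x : 'cV[R]_n, x != 0 -> 0 < (x^T *m M *m x) 0 0.

Definition enorm n (x : 'cV[R]_n) : R := Num.sqrt (\sum_i x i 0 ^+ 2).

(* The library norm [`|M|] on matrices is the max norm, not the spectral one. *)
Definition spectral_norm m n (M : 'M[R]_(m, n)) : R :=
  sup [set enorm (M *m x) | x in [set x : 'cV[R]_n | enorm x <= 1]].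

End matrices.

(* 'M[R]_(m, n) with its Borel sigma-algebra. *)
Notation borel_matrix R m n := (g_sigma_algebraType (@open 'M[R]_(m, n))).

Section probability.
Context {R : realType} {d d1 d2 : measure_display} {T : measurableType d}.
Context {T1 : measurableType d1} {T2 : measurableType d2}.
Variable Pr : probability T R.

Definition same_law (X Y : T -> T1) : Prop :=
  forall B, measurable B -> Pr (X @^-1` B) = Pr (Y @^-1` B).

Definition has_law (X : T -> T1) (mu : set T1 -> \bar R) : Prop :=
  forall B, measurable B -> Pr (X @^-1` B) = mu B.

Definition independent (X : T -> T1) (Y : T -> T2) : Prop :=
  forall B C, measurable B -> measurable C ->
    Pr ((X @^-1` B) `&` (Y @^-1` C)) = (Pr (X @^-1` B) * Pr (Y @^-1` C))%E.

Definition mutually_independent (I : choiceType) (X : I -> T -> T1) : Prop :=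
  forall (J : {fset I}) (B : I -> set T1),
    (forall i, i \in J -> measurable (B i)) ->
    Pr (\bigcap_(i in [set` J]) (X i @^-1` B i)) =
    (\prod_(i <- J) Pr (X i @^-1` B i))%E.

Definition expectation_mx m n (X : T -> 'M[R]_(m, n)) : 'M[R]_(m, n) :=
  \matrix_(i, j) fine ('E_Pr[fun w => X w i j])%E.

End probability.

Definition riccati_drift {R : realType} {d} {T : measurableType d}
    (Pr : probability T R) (S Nr Nt : nat)
    (A : 'M[R]_S) (B : 'M[R]_(S, Nr)) (Q : 'M[R]_S)
    (Rm : 'M[R]_Nt) (M : 'M[R]_Nr)
    (delta : T -> bool) (H : T -> 'M[R]_(Nr, Nt)) (P : 'M[R]_S) : 'M[R]_S :=
  A^T *m P *m A
  - expectation_mx Pr (fun w => let dk : R := (delta w)%:R in let Hk := H w in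
      dk *: (A^T *m P *m B *m Hk
        *m invmx (dk *: (Hk^T *m B^T *m P *m B *m Hk)
                  + dk *: (Hk^T *m M *m Hk) + Rm)
        *m Hk^T *m B^T *m P *m A))
  - P + Q.

Section interpolation_and_flow.
Context {R : realType} {V : normedModType R}.
Variable f : V -> V.

Fixpoint euler (xi : R) (P0 : V) (k : nat) : V :=
  if k is k'.+1 then euler xi P0 k' + xi *: f (euler xi P0 k') else P0.

Definition interp (xi : R) (u : nat -> V) (t : R) : V :=
  let k := Num.truncn (t / xi) in
  u k + (xi^-1 * (t - k%:R * xi)) *: (u k.+1 - u k).

Lemma interpE (xi : R) (u : nat -> V) (k : nat) (t : R) :
  0 < xi -> k%:R * xi <= t <= k.+1%:R * xi ->
  interp xi u t = u k + (xi^-1 * (t - k%:R * xi)) *: (u k.+1 - u k).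
Proof.
move=> xi0 /andP[kt]; rewrite le_eqVlt => /orP[/eqP ->|tk].
  rewrite /interp mulfK ?gt_eqF// natrK subrr mulr0 scale0r addr0.
  rewrite -mulrBl mulrCA mulVf ?gt_eqF// mulr1 -natrB// subSnn scale1r.
  by rewrite addrC subrK.
rewrite /interp (_ : Num.truncn (t / xi) = k)//; apply: truncn_def.
by rewrite ler_pdivlMr// kt ltr_pdivrMr.
Qed.

(* [f] is total, so [X] is only required to be continuous at the initial time
   [l], where the ODE then holds as a right derivative as soon as [f] is
   continuous at [X l]. *)
Definition trajectory (l : R) (X0 : V) (X : R -> V) : Prop :=
  [/\ X l = X0, {within `[l, +oo[, continuous X} &
      forall t, l < t -> is_derive t 1 X (f (X t))].

End interpolation_and_flow.

(* Main.v *)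
(* Write [G = H (H^T W H + R)^-1 H^T] with [W = B^T P B + M]. If [W >= c > 0] as
   a quadratic form, then [y = G x] satisfies [c |y|^2 <= y^T W y <= y^T x], so
   [G] is bounded uniformly in [H]; together with
   [G1 - G2 = G1 (W2 - W1) G2] this makes the drift bounded and Lipschitz on
   bounded sets of [P] with [W >= c], in particular on a fixed neighbourhood of
   each bounded set of positive semidefinite matrices. No moment of [H] is
   needed.  Euler iterates stay positive semidefinite and bounded up to any
   finite time, because [0 <= P B G B^T P <= P].  The error [E] of the
   interpolation satisfies [|E'| <= La (|E| + xi F)] as long as the trajectory
   is in that neighbourhood, and it cannot reach the barrier
   [xi (F + 1) (2 exp ((La + 1) (t - l)) - 1)], which for small [xi] keeps the
   trajectory inside; no a priori positivity or symmetry of the trajectory is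
   required. *)

Require Import Defs.
From HB Require Import structures.
From mathcomp Require Import all_boot all_order all_algebra finmap.
From mathcomp Require Import all_classical all_reals all_analysis.
From mathcomp Require Import measurable_realfun ring lra.

Set Implicit Arguments.
Unset Strict Implicit.
Unset Printing Implicit Defensive.

Import Order.TTheory GRing.Theory Num.Theory.
Import numFieldNormedType.Exports.

Local Open Scope classical_set_scope.
Local Open Scope ring_scope.

(** * Bilinear forms and positive semidefinite matrices *)

Section bilinear_forms.
Context {R : realType}.

Definition bform m n (M : 'M[R]_(m, n)) (x : 'cV[R]_m) (y : 'cV[R]_n) : R :=
  (x^T *m M *m y) 0 0.

Lemma bformDl m n (M : 'M[R]_(m, n)) x1 x2 y :
  bform M (x1 + x2) y = bform M x1 y + bform M x2 y.
Proof. by rewrite /bform linearD /= !mulmxDl mxE. Qed.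

Lemma bformDr m n (M : 'M[R]_(m, n)) x y1 y2 :
  bform M x (y1 + y2) = bform M x y1 + bform M x y2.
Proof. by rewrite /bform mulmxDr mxE. Qed.

Lemma bformZl m n (M : 'M[R]_(m, n)) a x y : bform M (a *: x) y = a * bform M x y.
Proof. by rewrite /bform linearZ /= -!scalemxAl mxE. Qed.

Lemma bformZr m n (M : 'M[R]_(m, n)) a x y : bform M x (a *: y) = a * bform M x y.
Proof. by rewrite /bform -!scalemxAr mxE. Qed.

Lemma bformD m n (M N : 'M[R]_(m, n)) x y :
  bform (M + N) x y = bform M x y + bform N x y.
Proof. by rewrite /bform mulmxDr mulmxDl mxE. Qed.

Lemma bformZ m n (M : 'M[R]_(m, n)) a x y : bform (a *: M) x y = a * bform M x y.
Proof. by rewrite /bform -scalemxAr -scalemxAl mxE. Qed.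

Lemma bformN m n (M : 'M[R]_(m, n)) x y : bform (- M) x y = - bform M x y.
Proof. by rewrite -scaleN1r bformZ mulN1r. Qed.

Lemma bform0l m n (M : 'M[R]_(m, n)) y : bform M 0 y = 0.
Proof. by rewrite /bform trmx0 !mul0mx mxE. Qed.

Lemma bform_tr m n (M : 'M[R]_(m, n)) x y : bform M^T y x = bform M x y.
Proof.
have e : y^T *m M^T *m x = (x^T *m M *m y)^T by rewrite !trmx_mul trmxK mulmxA.
by rewrite /bform e mxE.
Qed.

Lemma bform_mull m n p (A : 'M[R]_(p, m)) (M : 'M[R]_(p, n)) x y :
  bform (A^T *m M) x y = bform M (A *m x) y.
Proof. by rewrite /bform trmx_mul !mulmxA. Qed.

Lemma bform_mulr m n p (M : 'M[R]_(m, p)) (A : 'M[R]_(p, n)) x y :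
  bform (M *m A) x y = bform M x (A *m y).
Proof. by rewrite /bform !mulmxA. Qed.

Lemma bform_delta m n (M : 'M[R]_(m, n)) i j :
  bform M (delta_mx i 0) (delta_mx j 0) = M i j.
Proof. by rewrite /bform trmx_delta -rowE -colE !mxE. Qed.

Lemma bformE m n (M : 'M[R]_(m, n)) x y :
  bform M x y = \sum_i \sum_j x i 0 * M i j * y j 0.
Proof.
rewrite /bform mxE exchange_big; apply: eq_bigr => j _.
by rewrite mxE mulr_suml; apply: eq_bigr => i _; rewrite mxE.
Qed.

Lemma bform_deltal n (x : 'cV[R]_n) i : bform 1%:M (delta_mx i 0) x = x i 0.
Proof. by rewrite /bform mulmx1 trmx_delta -rowE mxE. Qed.

Lemma sqnormE n (x : 'cV[R]_n) : bform 1%:M x x = \sum_i x i 0 ^+ 2.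
Proof. by rewrite /bform mulmx1 mxE; apply: eq_bigr => i _; rewrite mxE. Qed.

Lemma sqnorm_ge0 n (x : 'cV[R]_n) : 0 <= bform 1%:M x x.
Proof. by rewrite sqnormE sumr_ge0// => i _; rewrite sqr_ge0. Qed.

Lemma sqr_coord_le n (x : 'cV[R]_n) i : x i 0 ^+ 2 <= bform 1%:M x x.
Proof.
by rewrite sqnormE (bigD1 i)//= lerDl sumr_ge0// => j _; rewrite sqr_ge0.
Qed.

Lemma sqnorm_delta n (i : 'I_n) : bform 1%:M (delta_mx i 0) (delta_mx i 0) = 1 :> R.
Proof. by rewrite bform_delta mxE eqxx. Qed.

Definition psdmx n (P : 'M[R]_n) := P^T = P /\ forall x, 0 <= bform P x x.

Lemma posdef_psd n (P : 'M[R]_n) : posdefmx P -> psdmx P.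
Proof.
move=> [PT P0]; split=> // x; have [->|x0] := eqVneq x 0; first by rewrite bform0l.
exact/ltW/P0.
Qed.

Lemma psd_sym n (P : 'M[R]_n) x y : psdmx P -> bform P y x = bform P x y.
Proof. by move=> [PT _]; rewrite -{1}PT bform_tr. Qed.

(** Discriminant argument: the form is nonnegative at every [s *: x + t *: y], and suitable values
    of [s] and [t] give the inequality. *)
Lemma psd_CauchySchwarz n (P : 'M[R]_n) x y : psdmx P ->
  bform P x y ^+ 2 <= bform P x x * bform P y y.
Proof.
move=> hP; have [_ P0] := hP.
pose a := bform P x x; pose b := bform P x y; pose c := bform P y y.
have q s t : 0 <= s ^+ 2 * a + 2 * (s * t) * b + t ^+ 2 * c.
  rewrite (_ : _ + _ = bform P (s *: x + t *: y) (s *: x + t *: y))//.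
  by rewrite bformDl !bformDr !bformZl !bformZr (psd_sym x y hP) -/a -/b -/c; ring.
rewrite -/a -/b -/c.
have [c0|c0] := ltrP 0 c.
  have := q c (- b).
  rewrite (_ : _ + _ = c * (a * c - b ^+ 2)); last by ring.
  by rewrite pmulr_rge0// subr_ge0.
have {c0} c0 : c = 0 by apply/eqP; rewrite eq_le c0 P0.
have [->|b0] := eqVneq b 0; first by rewrite c0 expr0n mulr0.
(* When [c = 0] and [s = 1] the form is affine in [t]; this [t] would give it the value -1. *)
have := q 1 (- (a + 1) / (2 * b)); rewrite c0 mulr0 addr0 expr1n !mul1r.
have -> : 2 * (- (a + 1) / (2 * b)) * b = - (a + 1) by field.
by lra.
Qed.

(** A kernel vector would make the form vanish. Positivity is stated for the form of a possibly
    non-symmetric matrix, since [K] will be built from points of the ODE trajectory. *)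
Lemma posform_unitmx n (K : 'M[R]_n) :
  (forall x, x != 0 -> 0 < bform K x x) -> K \in unitmx.
Proof.
move=> K0; rewrite -row_free_unit; apply: inj_row_free => v vK.
apply/eqP; apply: contraT => v0.
have := K0 v^T; rewrite /bform trmxK vK mul0mx mxE ltxx; apply.
by apply: contra v0 => /eqP e; rewrite -[v]trmxK e trmx0.
Qed.

(* Since [x i = x^T M (M^-1 e_i)], Cauchy-Schwarz for the form [M] bounds
   [x i ^+ 2] by a multiple of [x^T M x]. *)
Lemma posdef_lower_bound n (M : 'M[R]_n) : posdefmx M ->
  exists2 c : R, 0 < c & forall x, c * bform 1%:M x x <= bform M x x.
Proof.
move=> hM; have pM := posdef_psd hM; have [_ M0] := pM.
have uM : M \in unitmx by apply: posform_unitmx; case: hM.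
pose z i : 'cV[R]_n := invmx M *m delta_mx i 0.
pose s := 1 + \sum_i bform M (z i) (z i).
have s0 : 0 < s by rewrite ltr_wpDr// sumr_ge0.
exists s^-1; first by rewrite invr_gt0.
move=> x; rewrite ler_pdivrMl// sqnormE.
apply: (@le_trans _ _ (\sum_i bform M (z i) (z i) * bform M x x)).
  apply: ler_sum => i _; apply: le_trans (psd_CauchySchwarz _ _ pM).
  have -> : bform M (z i) x = x i 0.
    by rewrite (psd_sym _ _ pM) -bform_mulr mulmxV// -trmx1 bform_tr bform_deltal.
  by [].
by rewrite -mulr_suml ler_wpM2r// /s lerDr.
Qed.

End bilinear_forms.

(** * The matrix [gain W H]: bounds and dependence on [W] *)

Section gain.
Context {R : realType} {p n : nat}.
Variables (Rm : 'M[R]_n).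
Hypothesis Rm_gt0 : forall x, x != 0 -> 0 < bform Rm x x.
Implicit Types (W : 'M[R]_p) (H : 'M[R]_(p, n)).

Definition gain W H := H *m invmx (H^T *m W *m H + Rm) *m H^T.

Lemma gain_unitmx W H : (forall y, 0 <= bform W y y) ->
  H^T *m W *m H + Rm \in unitmx.
Proof.
move=> W0; apply: posform_unitmx => x /Rm_gt0 x0.
by rewrite bformD bform_mulr bform_mull ltr_wpDl.
Qed.

(** Put [K = H^T W H + Rm] and [v = K^-1 H^T x], so that [gain W H *m x = H v]. The right side is
    then [v^T K v], which exceeds the left side by [v^T Rm v]. *)
Lemma gain_le W H x : (forall y, 0 <= bform W y y) ->
  bform W (gain W H *m x) (gain W H *m x) <= bform 1%:M (gain W H *m x) x.
Proof.
move=> W0; have uK := gain_unitmx H W0.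
set K := _ + _ in uK; set v := invmx K *m (H^T *m x).
have -> : gain W H *m x = H *m v by rewrite /gain -/K !mulmxA.
have -> : bform 1%:M (H *m v) x = bform K v v.
  rewrite -bform_mull mulmx1 -[K in RHS]mul1mx bform_mulr /v !mulmxA mulmxV// mul1mx.
  by rewrite -bform_mulr mul1mx.
rewrite /K bformD bform_mulr bform_mull lerDl.
by have [->|/Rm_gt0/ltW//] := eqVneq v 0; rewrite bform0l.
Qed.

(** For the column [y] of index [j], [gain_le] gives [c |y|^2 <= y_j]. As [y_j^2 <= |y|^2], first
    [y_j <= c^-1], then [|y|^2 <= c^-2], whatever [H] is. *)
Lemma gain_bounded (c : R) W H i j : 0 < c ->
  (forall y, c * bform 1%:M y y <= bform W y y) -> `|gain W H i j| <= c^-1.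
Proof.
move=> c0 Wc.
have W0 y : 0 <= bform W y y.
  by apply: le_trans (Wc y); rewrite mulr_ge0 ?sqnorm_ge0 ?ltW.
pose y : 'cV[R]_p := gain W H *m delta_mx j 0.
have yE k : gain W H k j = y k 0 by rewrite /y -colE [RHS]mxE.
have yj : c * bform 1%:M y y <= y j 0.
  apply: le_trans (Wc y) _; apply: le_trans (gain_le _ _ W0) _.
  by rewrite -/y -trmx1 bform_tr bform_deltal.
have := sqr_coord_le y i; have := sqr_coord_le y j; rewrite yE.
move: yj; move: (bform _ _ _) (y i 0) (y j 0) => s a b sb bs as_.
have ci : c * c^-1 = 1 by rewrite mulfV ?gt_eqF.
have ci0 : 0 < c^-1 by rewrite invr_gt0.
have b_le : b <= c^-1.
  rewrite leNgt; apply/negP => cb.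
  have : c * b ^+ 2 <= b by apply: le_trans sb; rewrite ler_pM2l.
  by move: cb; rewrite -(ltr_pM2l c0) ci; nra.
have s_le : s <= c^-1 ^+ 2.
  by rewrite expr2 -(ler_pM2l c0) mulrA ci mul1r (le_trans sb).
rewrite -(@ler_pXn2r _ 2)// ?nnegrE ?(ltW ci0)// real_normK ?num_real//.
exact: le_trans as_ s_le.
Qed.

(** This is the resolvent identity [K1^-1 - K2^-1 = K1^-1 (K2 - K1) K2^-1], in which [Rm] cancels
    from [K2 - K1]. *)
Lemma gainB W1 W2 H : (forall y, 0 <= bform W1 y y) ->
  (forall y, 0 <= bform W2 y y) ->
  gain W1 H - gain W2 H = gain W1 H *m (W2 - W1) *m gain W2 H.
Proof.
move=> /(gain_unitmx H) u1 /(gain_unitmx H) u2; rewrite /gain.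
set K1 := _ + _ in u1 *; set K2 := H^T *m W2 *m H + Rm in u2 *.
have e : invmx K1 = invmx K1 *m (K2 - K1) *m invmx K2 + invmx K2.
  by rewrite mulmxBr mulVmx// mulmxBl mul1mx -mulmxA mulmxV// mulmx1 subrK.
rewrite {1}e mulmxDr mulmxDl addrK.
have -> : K2 - K1 = H^T *m (W2 - W1) *m H.
  by rewrite /K1 /K2 opprD addrACA subrr addr0 mulmxBr mulmxBl.
by rewrite !mulmxA.
Qed.

Lemma gain_tr W H : W^T = W -> Rm^T = Rm -> (gain W H)^T = gain W H.
Proof.
move=> WT RT; rewrite /gain !trmx_mul trmxK trmx_inv linearD /= !trmx_mul trmxK.
by rewrite WT RT !mulmxA.
Qed.

(** For [u = B G B^T P x] the middle term is [P(x, u)], and [gain_le] yields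
    [0 <= P(u, u) <= P(x, u)]. Expanding [P(x - u, x - u) >= 0] then gives [P(x, u) <= P(x, x)]. *)
Lemma gain_riccati_le q (P : 'M[R]_q) (B : 'M[R]_(q, p)) (M : 'M[R]_p) H x :
  psdmx P -> (forall y, 0 <= bform M y y) ->
  0 <= bform (P *m B *m gain (B^T *m P *m B + M) H *m B^T *m P) x x <= bform P x x.
Proof.
move=> hP M0; have [PT P0] := hP; set W := _ + M; set G := gain W H.
have W0 y : 0 <= bform W y y.
  by rewrite bformD bform_mulr bform_mull addr_ge0.
pose u : 'cV[R]_q := B *m (G *m (B^T *m P *m x)).
have -> : bform (P *m B *m G *m B^T *m P) x x = bform P x u.
  by rewrite /u -!bform_mulr !mulmxA.
have uPx : bform P u u <= bform P x u.
  apply: (@le_trans _ _ (bform W (G *m (B^T *m P *m x)) (G *m (B^T *m P *m x)))).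
    by rewrite bformD bform_mulr bform_mull lerDl.
  apply: le_trans (gain_le _ _ W0) _.
  by rewrite -bform_mulr mul1mx bform_mull (psd_sym _ _ hP).
have := P0 (x - u); rewrite bformDl !bformDr -scaleN1r !bformZl !bformZr.
have := P0 u; rewrite -(psd_sym _ _ hP); move: uPx; rewrite -(psd_sym _ _ hP).
by move: (bform P x x) (bform P u x) (bform P u u) => *; apply/andP; split; lra.
Qed.

End gain.

(** * Estimates in the max norm, and comparison with the spectral norm *)

Section matrix_norms.
Context {R : realType}.

Lemma ler_mx_normP m n (M : 'M[R]_(m, n)) (c : R) : 0 <= c ->
  `|M| <= c <-> forall i j, `|M i j| <= c.
Proof.
move=> c0; rewrite [leLHS]mx_normrE; split=> [Mc i j|Mc].
  by apply: le_trans Mc; exact: (le_bigmax _ (fun ij => `|M ij.1 ij.2|) (i, j)).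
by apply: bigmax_le => // -[i j] _; exact: Mc.
Qed.

Lemma coord_le_mx_norm m n (M : 'M[R]_(m, n)) i j : `|M i j| <= `|M|.
Proof. exact: (ler_mx_normP M (normr_ge0 M)).1. Qed.

Lemma ler_norm_mulmx m n p (A : 'M[R]_(m, n)) (B : 'M[R]_(n, p)) (a b : R) :
  `|A| <= a -> `|B| <= b -> `|A *m B| <= n%:R * (a * b).
Proof.
move=> Aa Bb; have a0 := le_trans (normr_ge0 _) Aa.
have b0 := le_trans (normr_ge0 _) Bb.
apply/ler_mx_normP; first by rewrite !mulr_ge0.
move=> i j; rewrite mxE; apply: le_trans (ler_norm_sum _ _ _) _.
rewrite mulr_natl -[in leRHS](card_ord n) -sumr_const; apply: ler_sum => k _.
by rewrite normrM ler_pM// (le_trans (coord_le_mx_norm _ _ _)).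
Qed.

Lemma ler_norm_mulmxl m n p (A : 'M[R]_(m, n)) (B : 'M[R]_(n, p)) (a b e : R) :
  `|A| <= a * e -> `|B| <= b -> `|A *m B| <= n%:R * (a * b) * e.
Proof.
move=> Aa Bb; apply: le_trans (ler_norm_mulmx Aa Bb) _.
by rewrite -!mulrA [e * b]mulrC.
Qed.

Lemma ler_norm_mulmxr m n p (A : 'M[R]_(m, n)) (B : 'M[R]_(n, p)) (a b e : R) :
  `|A| <= a -> `|B| <= b * e -> `|A *m B| <= n%:R * (a * b) * e.
Proof. by move=> Aa Bb; apply: le_trans (ler_norm_mulmx Aa Bb) _; rewrite -!mulrA. Qed.

Lemma ler_norm_addl m n (A B : 'M[R]_(m, n)) (a b e : R) :
  `|A| <= a * e -> `|B| <= b * e -> `|A + B| <= (a + b) * e.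
Proof. by move=> Aa Bb; rewrite mulrDl (le_trans (ler_normD _ _))// lerD. Qed.

Lemma bform_norm n (N : 'M[R]_n) x :
  `|bform N x x| <= (n * n)%:R * `|N| * bform 1%:M x x.
Proof.
rewrite [bform N x x]bformE; set q := bform _ _ _.
(* The product is at most the mean of the two squares, each of which is at most [q]. *)
have xx i j : `|x i 0| * `|x j 0| <= q.
  have := sqr_coord_le x i; have := sqr_coord_le x j.
  rewrite -/q -[x i 0 ^+ 2]real_normK ?num_real// -[x j 0 ^+ 2]real_normK ?num_real//.
  by have := sqr_ge0 (`|x i 0| - `|x j 0|); nra.
apply: le_trans (ler_norm_sum _ _ _) _.
apply: (@le_trans _ _ (\sum_(i < n) \sum_(j < n) `|N| * q)).
  apply: ler_sum => i _; apply: le_trans (ler_norm_sum _ _ _) _.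
  apply: ler_sum => j _; rewrite !normrM mulrAC mulrC.
  by rewrite ler_pM ?mulr_ge0// coord_le_mx_norm.
by rewrite !sumr_const card_ord -mulrA mulr_natl mulrnA.
Qed.

(** Cauchy-Schwarz on basis vectors bounds [P i j ^+ 2] by [P i i * P j j], so the diagonal controls
    the max norm. *)
Lemma psd_norm_le n (P : 'M[R]_n) (b : R) : psdmx P -> 0 <= b ->
  (forall x, bform P x x <= b * bform 1%:M x x) -> `|P| <= b.
Proof.
move=> hP b0 Pb; apply/ler_mx_normP => // i j.
have := psd_CauchySchwarz (delta_mx i 0) (delta_mx j 0) hP.
have := Pb (delta_mx i 0); have := Pb (delta_mx j 0).
have := hP.2 (delta_mx i 0); have := hP.2 (delta_mx j 0).
rewrite !sqnorm_delta !mulr1 !bform_delta => Pj Pi bj bi PP.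
rewrite -(@ler_pXn2r _ 2)// ?nnegrE// real_normK ?num_real//.
by rewrite (le_trans PP)// expr2 ler_pM.
Qed.

Lemma spectral_norm_le m n (M : 'M[R]_(m, n)) :
  spectral_norm M <= (m * n)%:R * `|M|.
Proof.
apply: ge_sup.
  exists (enorm (M *m (0 : 'cV[R]_n))), 0 => //=.
  by rewrite /enorm big1 ?sqrtr0// => i _; rewrite mxE expr0n.
move=> _ [x /= x1 <-].
have x1' i : `|x i 0| <= 1.
  apply: le_trans x1; rewrite /enorm -[leLHS]sqrtr_sqr; apply: ler_wsqrtr.
  by rewrite (bigD1 i)//= lerDl sumr_ge0// => j _; rewrite sqr_ge0.
have x1n : `|x| <= 1 by apply/ler_mx_normP => // i j; rewrite ord1.
have Mx := ler_norm_mulmx (lexx `|M|) x1n; rewrite mulr1 in Mx.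
rewrite /enorm -[leRHS]ger0_norm ?mulr_ge0// -sqrtr_sqr; apply: ler_wsqrtr.
apply: (@le_trans _ _ (\sum_(i < m) (n%:R * `|M|) ^+ 2)).
  apply: ler_sum => i _; rewrite -[leLHS]real_normK ?num_real//.
  by rewrite ler_pXn2r ?nnegrE ?mulr_ge0// (le_trans (coord_le_mx_norm _ _ _)).
(* The sum contributes a factor [m], which is replaced by the larger [m ^ 2]. *)
rewrite sumr_const card_ord natrM -mulrA [leRHS]exprMn -[leLHS]mulr_natl.
by rewrite ler_wpM2r ?sqr_ge0// -natrX ler_nat; case: (m) => // k; rewrite leq_pmulr.
Qed.

End matrix_norms.

(** * Entrywise measurability of random matrices *)

Section measurable_matrices.
Context {R : realType} {d : measure_display} {T : measurableType d}.

Definition measurable_mx m n (X : T -> 'M[R]_(m, n)) :=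
  forall i j, measurable_fun setT (fun w => X w i j).

Lemma measurable_inv : measurable_fun setT (GRing.inv : R -> R).
Proof.
(* This rewrites the inverse through [expR] and [ln]; at 0 both sides vanish, as [0^-1 = 0] by
   convention. *)
have -> : (GRing.inv : R -> R) = (fun x : R => x * expR (- ln (x ^+ 2))).
  apply/funext => x; have [->|x0] := eqVneq x 0; first by rewrite invr0 mul0r.
  have x2 : 0 < x ^+ 2 by rewrite exprn_even_gt0.
  by rewrite expRN lnK// expr2 invfM mulrA mulfV// mul1r.
apply: measurable_funM => //; apply: measurableT_comp => //.
by apply: measurable_funN; apply: measurableT_comp => //; exact: measurable_ln.
Qed.

Lemma measurable_mx_cst m n (A : 'M[R]_(m, n)) : measurable_mx (fun=> A).
Proof. by move=> i j; exact: measurable_cst. Qed.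

Lemma measurable_mxD m n (X Y : T -> 'M[R]_(m, n)) :
  measurable_mx X -> measurable_mx Y -> measurable_mx (fun w => X w + Y w).
Proof.
move=> mX mY i j; rewrite (_ : (fun _ => _) = (fun w => X w i j + Y w i j)).
  exact: measurable_funD.
by apply/funext => w; rewrite mxE.
Qed.

Lemma measurable_mxN m n (X : T -> 'M[R]_(m, n)) :
  measurable_mx X -> measurable_mx (fun w => - X w).
Proof.
move=> mX i j; rewrite (_ : (fun _ => _) = (fun w => - X w i j)).
  exact: measurable_funN.
by apply/funext => w; rewrite mxE.
Qed.

Lemma measurable_mxZ m n (a : T -> R) (X : T -> 'M[R]_(m, n)) :
  measurable_fun setT a -> measurable_mx X -> measurable_mx (fun w => a w *: X w).
Proof.
move=> ma mX i j; rewrite (_ : (fun _ => _) = (fun w => a w * X w i j)).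
  exact: measurable_funM.
by apply/funext => w; rewrite mxE.
Qed.

Lemma measurable_mxM m n p (X : T -> 'M[R]_(m, n)) (Y : T -> 'M[R]_(n, p)) :
  measurable_mx X -> measurable_mx Y -> measurable_mx (fun w => X w *m Y w).
Proof.
move=> mX mY i j.
rewrite (_ : (fun _ => _) = (fun w => \sum_k X w i k * Y w k j)).
  by apply: measurable_sum => k; exact: measurable_funM.
by apply/funext => w; rewrite mxE.
Qed.

Lemma measurable_mx_tr m n (X : T -> 'M[R]_(m, n)) :
  measurable_mx X -> measurable_mx (fun w => (X w)^T).
Proof.
move=> mX i j; rewrite (_ : (fun _ => _) = (fun w => X w j i))//.
by apply/funext => w; rewrite mxE.
Qed.

Lemma measurable_det n (X : T -> 'M[R]_n) :
  measurable_mx X -> measurable_fun setT (fun w => \det (X w)).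
Proof.
move=> mX; apply: measurable_sum => s; apply: measurable_funM => //.
by apply: measurable_prod => i _; exact: mX.
Qed.

(** Invertibility at every [w] keeps [invmx] equal to adjugate over determinant, whose entries are
    polynomials divided by a polynomial. *)
Lemma measurable_invmx n (X : T -> 'M[R]_n) :
  (forall w, X w \in unitmx) -> measurable_mx X ->
  measurable_mx (fun w => invmx (X w)).
Proof.
move=> uX mX.
rewrite (_ : (fun _ => _) = (fun w => (\det (X w))^-1 *: \adj (X w))); last first.
  by apply/funext => w; rewrite /invmx uX.
apply: measurable_mxZ.
  by apply: (measurableT_comp measurable_inv); exact: measurable_det.
move=> i j; rewrite (_ : (fun _ => _) = (fun w => cofactor (X w) j i)); last first.
  by apply/funext => w; rewrite mxE.
apply: measurable_funM => //; apply: measurable_det => k l.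
rewrite (_ : (fun _ => _) = (fun w => X w (lift j k) (lift i l)))//.
by apply/funext => w; rewrite !mxE.
Qed.

(** Coordinates are continuous and open intervals generate the Borel sets of [R], so it suffices
    that preimages of intervals are open. *)
Lemma measurable_borel_matrix m n (X : T -> borel_matrix R m n) :
  measurable_fun setT X -> measurable_mx (X : T -> 'M[R]_(m, n)).
Proof.
move=> mX i j.
apply: (measurableT_comp (f := fun M : borel_matrix R m n => (M : 'M[R]_(m, n)) i j)) => //.
apply: (measurability _ (RGenOpens.measurableE R)).
move=> _ [_ [a [b ->] <-]]; rewrite setTI; apply: sub_sigma_algebra.
by move/continuousP: (@coord_continuous R m n i j); apply; exact: interval_open.
Qed.

End measurable_matrices.

(** * Expectations of bounded random matrices *)

Section bounded_expectation.
Context {R : realType} {d : measure_display} {T : measurableType d}.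
Variable Pr : probability T R.

Lemma bounded_integrable (X : T -> R) (c : R) :
  measurable_fun setT X -> (forall w, `|X w| <= c) ->
  Pr.-integrable setT (EFin \o X).
Proof.
move=> mX Xc; apply: measurable_bounded_integrable => //.
  by rewrite [X in (X < _)%E](@probability_setT _ _ _ Pr) ltry.
exists c; split; first exact: num_real.
by move=> M /ltW cM w _ /=; apply: le_trans cM.
Qed.

Lemma Rintegral_cst_prob (c : R) : \int[Pr]_(w in setT) c = c.
Proof.
rewrite Rintegral_cst// (_ : fine _ = 1) ?mulr1//.
exact: (congr1 fine (@probability_setT _ _ _ Pr)).
Qed.

Lemma Rintegral_sum I (s : seq I) (f : I -> T -> R) :
  (forall i, Pr.-integrable setT (EFin \o f i)) ->
  \int[Pr]_(w in setT) (\sum_(i <- s) f i w) = \sum_(i <- s) \int[Pr]_(w in setT) f i w.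
Proof.
move=> fi; elim: s => [|i s ih].
  by under [LHS]eq_Rintegral do rewrite big_nil; rewrite Rintegral_cst_prob big_nil.
under [LHS]eq_Rintegral do rewrite big_cons.
rewrite RintegralD ?big_cons ?ih//.
rewrite (_ : _ \o _ = (fun w => \sum_(j <- s) (EFin \o f j) w)%E).
  exact: integrable_sum.
by apply/funext => w; rewrite /= sumEFin.
Qed.

Lemma integrable_mulrl (a : R) (f : T -> R) : Pr.-integrable setT (EFin \o f) ->
  Pr.-integrable setT (EFin \o (fun w => a * f w)).
Proof. by move=> fi; apply: (integrableZl _ a fi). Qed.

Context {m n : nat}.
Variable X : T -> 'M[R]_(m, n).
Hypothesis mX : measurable_mx X.
Variable c : R.
Hypothesis Xc : forall w, `|X w| <= c.

Lemma entry_integrable i j : Pr.-integrable setT (EFin \o (fun w => X w i j)).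
Proof.
apply: (bounded_integrable (mX i j)) => w.
by rewrite (le_trans (coord_le_mx_norm _ _ _)).
Qed.

Lemma expectation_mxE i j : expectation_mx Pr X i j = \int[Pr]_(w in setT) X w i j.
Proof. by rewrite mxE unlock. Qed.

Lemma bform_integrable x y :
  Pr.-integrable setT (EFin \o (fun w => bform (X w) x y)).
Proof.
rewrite (_ : _ \o _ =
  (fun w => \sum_i \sum_j (x i 0 * y j 0)%:E * (EFin \o (fun w => X w i j)) w)%E).
  apply: integrable_sum => //i _; apply: integrable_sum => //j _.
  by apply: integrableZl => //; exact: entry_integrable.
apply/funext => w; rewrite /= bformE -sumEFin; apply: eq_bigr => i _.
by rewrite -sumEFin; apply: eq_bigr => j _; rewrite mulrAC EFinM.
Qed.

Lemma bform_expectation_mx x y :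
  bform (expectation_mx Pr X) x y = \int[Pr]_(w in setT) bform (X w) x y.
Proof.
have iX i j : Pr.-integrable setT (EFin \o (fun w => x i 0 * y j 0 * X w i j)).
  by apply: integrable_mulrl; exact: entry_integrable.
rewrite bformE.
rewrite (_ : (fun w => bform (X w) x y) =
   fun w => \sum_(ij : 'I_m * 'I_n) x ij.1 0 * y ij.2 0 * X w ij.1 ij.2).
  rewrite Rintegral_sum// -(pair_bigA _ (fun i j =>
    \int[Pr]_(w in setT) (x i 0 * y j 0 * X w i j)))/=.
  apply: eq_bigr => i _; apply: eq_bigr => j _.
  by rewrite expectation_mxE mulrAC RintegralZl//; exact: entry_integrable.
apply/funext => w; rewrite bformE pair_bigA/=.
by apply: eq_bigr => ij _; rewrite mulrAC.
Qed.

(** Forms commute with the expectation and [Pr] has mass one, so pointwise bounds survive averaging.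
    On basis vectors this bounds entries; on the diagonal [x = y] it transfers semidefinite
    bounds. *)
Lemma bform_expectation_mx_bounds x y (a b : R) :
  (forall w, a <= bform (X w) x y <= b) ->
  a <= bform (expectation_mx Pr X) x y <= b.
Proof.
move=> ab; rewrite bform_expectation_mx; have iX := bform_integrable x y.
have ic k : Pr.-integrable setT (EFin \o (fun=> k : R)).
  by apply: (@bounded_integrable _ `|k|).
rewrite -[a in X in X && _]Rintegral_cst_prob -[b in X in _ && X]Rintegral_cst_prob.
by apply/andP; split; apply: le_Rintegral => // w _; have /andP[] := ab w.
Qed.

Lemma norm_expectation_mx : `|expectation_mx Pr X| <= c.
Proof.
(* The sample space is inhabited, hence the bound [c] dominates an actual norm. *)
have c0 : 0 <= c by rewrite (le_trans _ (Xc point)).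
apply/ler_mx_normP => // i j; rewrite ler_norml -bform_delta.
apply: bform_expectation_mx_bounds => w.
by rewrite bform_delta -ler_norml (le_trans (coord_le_mx_norm _ _ _)).
Qed.

End bounded_expectation.

Lemma expectation_mxB {R : realType} {d : measure_display} {T : measurableType d}
    (Pr : probability T R) m n (X Y : T -> 'M[R]_(m, n)) (a b : R) :
  measurable_mx X -> measurable_mx Y ->
  (forall w, `|X w| <= a) -> (forall w, `|Y w| <= b) ->
  expectation_mx Pr X - expectation_mx Pr Y = expectation_mx Pr (fun w => X w - Y w).
Proof.
move=> mX mY Xa Yb; apply/matrixP => i j; rewrite [LHS]mxE [X in _ + X]mxE !expectation_mxE.
rewrite -RintegralB//; [|exact: entry_integrable Xa i j|exact: entry_integrable Yb i j].
by apply: eq_Rintegral => w _; rewrite !mxE.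
Qed.

(** The three varying factors are exchanged one at a time. *)
Lemma mulmx_telescope {R : pzRingType} n p (P1 P2 : 'M[R]_n) (B : 'M[R]_(n, p))
    (G1 G2 : 'M[R]_p) (C : 'M[R]_(p, n)) :
  P1 *m B *m G1 *m C *m P1 - P2 *m B *m G2 *m C *m P2 =
  (P1 - P2) *m B *m G1 *m C *m P1 + P2 *m B *m (G1 - G2) *m C *m P1
    + P2 *m B *m G2 *m C *m (P1 - P2).
Proof. by rewrite !mulmxBl !mulmxBr !mulmxBl !addrA !subrK. Qed.

(** * The Riccati drift: regularity, and bounds for its Euler iterates *)

Section riccati.
Context {R : realType} {d : measure_display} {T : measurableType d}.
Variables (Pr : probability T R) (S Nr Nt : nat).
Variables (A : 'M[R]_S) (B : 'M[R]_(S, Nr)) (Q : 'M[R]_S).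
Variables (Rm : 'M[R]_Nt) (M : 'M[R]_Nr).
Hypotheses (hQ : posdefmx Q) (hR : posdefmx Rm).
Variable c : R.
Hypothesis c_gt0 : 0 < c.
Hypothesis M_sym : M^T = M.
Hypothesis M_ge : forall y, 2 * c * bform 1%:M y y <= bform M y y.
Variables (delta : T -> bool) (H : T -> 'M[R]_(Nr, Nt)).
Hypotheses (mdelta : measurable_fun setT delta) (mH : measurable_mx H).

Definition riccati_sample (P : 'M[R]_S) w : 'M[R]_S :=
  (delta w)%:R *:
  (A^T *m (P *m B *m gain Rm (B^T *m P *m B + M) (H w) *m B^T *m P) *m A).

(** For [delta w = 1] the inverse in the drift is the one in [gain] with [W = B^T P B + M]; for
    [delta w = 0] both integrands vanish. *)
Lemma riccati_driftE P :
  riccati_drift Pr A B Q Rm M delta H P =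
  A^T *m P *m A - expectation_mx Pr (riccati_sample P) - P + Q.
Proof.
rewrite /riccati_drift; do 3 congr (_ + _); congr (- expectation_mx _ _).
apply/funext => w; rewrite /riccati_sample /gain.
case: (delta w); rewrite ?scale0r// !scale1r mulmxDr mulmxDl.
by rewrite !mulmxA.
Qed.

(** The constant is [c] whereas [M] satisfies the bound with [2 * c]: the difference is the slack
    left for perturbing a semidefinite [P]. *)
Definition admissible (P : 'M[R]_S) :=
  forall y, c * bform 1%:M y y <= bform (B^T *m P *m B + M) y y.

Lemma psd_admissible P : psdmx P -> admissible P.
Proof.
move=> [_ P0] y; rewrite bformD bform_mulr bform_mull.
have := P0 (B *m y); have := M_ge y; have := sqnorm_ge0 y.
by have := c_gt0; nra.
Qed.

Lemma near_psd_admissible : exists2 r : R, 0 < r &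
  forall P P', psdmx P -> `|P' - P| <= r -> admissible P'.
Proof.
pose s : R := (Nr * Nr)%:R * (S%:R * (S%:R * (`|B^T| * 1) * `|B|)).
have s0 : 0 <= s by rewrite !mulr_ge0.
(* A perturbation of norm at most [r] moves the form by at most [s * r] times [|y|^2], and this [r]
   makes [s * r <= c]; the 1 covers [s = 0]. *)
exists (c / (1 + s)); first by rewrite divr_gt0// ltr_wpDr.
move=> P P' [_ P0] PP' y.
have P'E : P' = P + (P' - P) by rewrite addrC subrK.
rewrite P'E mulmxDr mulmxDl !bformD [bform (_ *m P *m _) _ _]bform_mulr bform_mull.
set D := P' - P in PP' *; set q := bform 1%:M y y.
have BDB : (Nr * Nr)%:R * `|B^T *m D *m B| <= s * (c / (1 + s)).
  rewrite /s -[leRHS]mulrA ler_wpM2l//.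
  apply: (ler_norm_mulmxl (b := `|B|) (a := S%:R * (`|B^T| * 1))) => //.
  by apply: ler_norm_mulmxr => //; rewrite mul1r.
have sc : s * (c / (1 + s)) <= c.
  by rewrite mulrCA ler_piMr ?(ltW c_gt0)// ler_pdivrMr ?ltr_wpDr// mul1r lerDr.
have := bform_norm (B^T *m D *m B) y; rewrite ler_norml => /andP[+ _].
have := ler_wpM2r (sqnorm_ge0 y) (le_trans BDB sc).
have := P0 (B *m y); have := M_ge y; rewrite -/q.
rewrite [2 * c * q](_ : _ = c * q + c * q); last by ring.
by move: (c * q) (bform P _ _) (bform (_ *m B) _ _) (bform M _ _) => *; lra.
Qed.

Let Rm_gt0 x : x != 0 -> 0 < bform Rm x x.
Proof. exact: hR.2. Qed.

Let admissible_ge0 P y : admissible P -> 0 <= bform (B^T *m P *m B + M) y y.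
Proof. by move/(_ y); apply: le_trans; rewrite mulr_ge0 ?sqnorm_ge0 ?ltW. Qed.

Lemma measurable_riccati_sample P : admissible P -> measurable_mx (riccati_sample P).
Proof.
move=> aP; apply: measurable_mxZ.
  rewrite (_ : (fun _ => _) = (fun w => if delta w then 1 else 0)).
    exact: measurable_fun_ifT.
  by apply/funext => w; case: (delta w).
have mc := @measurable_mx_cst R d T.
do 2 ?[apply: measurable_mxM; last exact: mc]; apply: measurable_mxM; first exact: mc.
do 2 ?[apply: measurable_mxM; last exact: mc]; apply: measurable_mxM; first exact: mc.
apply: measurable_mxM; last exact: measurable_mx_tr.
apply: measurable_mxM => //; apply: measurable_invmx.
  by move=> w; apply: gain_unitmx => // y; exact: admissible_ge0.
apply: measurable_mxD; last exact: mc.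
apply: measurable_mxM => //; apply: measurable_mxM => //.
exact: measurable_mx_tr.
Qed.

Lemma norm_gain_le P w : admissible P ->
  `|gain Rm (B^T *m P *m B + M) (H w)| <= c^-1.
Proof.
move=> aP; apply/ler_mx_normP; first by rewrite invr_ge0 ltW.
by move=> i j; exact: gain_bounded.
Qed.

Lemma norm_delta_scale_le w m n (X : 'M[R]_(m, n)) : `|(delta w)%:R *: X| <= `|X|.
Proof. by rewrite normrZ; case: (delta w); rewrite ?normr1 ?mul1r// normr0 mul0r. Qed.

Lemma riccati_sample_bounded (b : R) : exists s : R, forall P w,
  admissible P -> `|P| <= b -> `|riccati_sample P w| <= s.
Proof.
(* The constant is left open and read off from the nested product bounds below; it does not depend
   on [w] because [norm_gain_le] does not. *)
eexists => P w aP Pb; apply: le_trans (norm_delta_scale_le _ _) _.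
exact: (ler_norm_mulmx (ler_norm_mulmx (lexx _) (ler_norm_mulmx (ler_norm_mulmx
  (ler_norm_mulmx (ler_norm_mulmx Pb (lexx _)) (norm_gain_le w aP)) (lexx _)) Pb))
  (lexx _)).
Qed.

(** Telescoping leaves terms containing [P1 - P2] or [G1 - G2], and by [gainB] the latter is
    [G1 B^T (P2 - P1) B G2], with bounded outer factors. *)
Lemma riccati_sample_lipschitz (b : R) : exists s : R, forall P1 P2 w,
  admissible P1 -> admissible P2 -> `|P1| <= b -> `|P2| <= b ->
  `|riccati_sample P1 w - riccati_sample P2 w| <= s * `|P1 - P2|.
Proof.
eexists => P1 P2 w aP1 aP2 P1b P2b; rewrite -scalerBr.
apply: le_trans (norm_delta_scale_le _ _) _.
have G1b := norm_gain_le w aP1; have G2b := norm_gain_le w aP2.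
have GB := gainB Rm_gt0 (H w) (fun y => admissible_ge0 y aP1)
  (fun y => admissible_ge0 y aP2).
set G1 := gain _ _ _ in G1b GB *; set G2 := gain _ _ _ in G2b GB *.
have {}GB : G1 - G2 = G1 *m (B^T *m (P2 - P1) *m B) *m G2.
  rewrite GB; congr (_ *m _ *m _).
  by rewrite opprD addrACA subrr addr0 mulmxBr mulmxBl.
have PP : `|P1 - P2| <= 1 * `|P1 - P2| by rewrite mul1r.
have PP' : `|P2 - P1| <= 1 * `|P1 - P2| by rewrite distrC.
have G12 := ler_norm_mulmxl (ler_norm_mulmxr G1b
  (ler_norm_mulmxl (ler_norm_mulmxr (lexx `|B^T|) PP') (lexx `|B|))) G2b.
rewrite -GB in G12.
rewrite -mulmxBl -mulmxBr.
rewrite mulmx_telescope.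
exact: (ler_norm_mulmxl (ler_norm_mulmxr (lexx _) (ler_norm_addl (ler_norm_addl
  (ler_norm_mulmxl (ler_norm_mulmxl (ler_norm_mulmxl
     (ler_norm_mulmxl PP (lexx _)) G1b) (lexx _)) P1b)
  (ler_norm_mulmxl (ler_norm_mulmxl (ler_norm_mulmxr
     (ler_norm_mulmx P2b (lexx _)) G12) (lexx _)) P1b))
  (ler_norm_mulmxr (ler_norm_mulmx (ler_norm_mulmx
     (ler_norm_mulmx P2b (lexx _)) G2b) (lexx _)) PP))) (lexx _)).
Qed.

Local Notation f := (riccati_drift Pr A B Q Rm M delta H).

Lemma riccati_drift_bounded (b : R) : exists s : R, forall P,
  admissible P -> `|P| <= b -> `|f P| <= s.
Proof.
have [s sP] := riccati_sample_bounded b; eexists => P aP Pb.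
rewrite riccati_driftE.
have Es := norm_expectation_mx Pr (measurable_riccati_sample aP)
  (fun w => sP P w aP Pb).
have APA := ler_norm_mulmx (ler_norm_mulmx (lexx `|A^T|) Pb) (lexx `|A|).
exact: (le_trans (ler_normD _ _) (lerD (le_trans (ler_normB _ _)
  (lerD (le_trans (ler_normB _ _) (lerD APA Es)) Pb)) (lexx _))).
Qed.

Lemma riccati_drift_lipschitz (b : R) : exists s : R, forall P1 P2,
  admissible P1 -> admissible P2 -> `|P1| <= b -> `|P2| <= b ->
  `|f P1 - f P2| <= s * `|P1 - P2|.
Proof.
have [s sP] := riccati_sample_lipschitz b.
have [t tP] := riccati_sample_bounded b.
eexists => P1 P2 aP1 aP2 P1b P2b; rewrite !riccati_driftE.
have m1 := measurable_riccati_sample aP1; have m2 := measurable_riccati_sample aP2.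
have EE := expectation_mxB Pr m1 m2 (fun w => tP P1 w aP1 P1b) (fun w => tP P2 w aP2 P2b).
have {}EE : `|expectation_mx Pr (riccati_sample P2) -
    expectation_mx Pr (riccati_sample P1)| <= s * `|P1 - P2|.
  rewrite distrC EE; apply: norm_expectation_mx => [|w]; last exact: sP.
  by move=> i j; apply: (measurable_mxD m1 (measurable_mxN m2)).
have PP : `|P1 - P2| <= 1 * `|P1 - P2| by rewrite mul1r.
have PP' : `|P2 - P1| <= 1 * `|P1 - P2| by rewrite distrC.
set E2 := expectation_mx _ _ in EE *; set E1 := expectation_mx _ _ in EE *.
rewrite (_ : _ - _ = A^T *m (P1 - P2) *m A + (E2 - E1) + (P2 - P1)); last first.
  rewrite mulmxBr mulmxBl !opprD !opprK addrACA subrr addr0 addrACA.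
  by rewrite [X in X + _]addrACA [- E1 + _]addrC [- P1 + _]addrC.
exact: (ler_norm_addl (ler_norm_addl (ler_norm_mulmxl (ler_norm_mulmxr (lexx _) PP)
  (lexx _)) EE) PP').
Qed.

Lemma riccati_sample_tr P w : P^T = P -> (riccati_sample P w)^T = riccati_sample P w.
Proof.
move=> PT; rewrite /riccati_sample linearZ /=; congr (_ *: _).
have WT : (B^T *m P *m B + M)^T = B^T *m P *m B + M.
  by rewrite linearD /= !trmx_mul trmxK PT M_sym mulmxA.
have := gain_tr (H w) WT hR.1; move: (gain _ _ _) => G GT.
by rewrite !trmx_mul !trmxK PT GT !mulmxA.
Qed.

Lemma riccati_drift_tr P : P^T = P -> (f P)^T = f P.
Proof.
move=> PT; rewrite riccati_driftE !(linearD, linearN) /= !trmx_mul trmxK PT.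
rewrite hQ.1 mulmxA; do 3 congr (_ + _); congr (- _).
apply/matrixP => i j; rewrite mxE !expectation_mxE.
by apply: eq_Rintegral => w _; rewrite -[in RHS](riccati_sample_tr w PT) [RHS]mxE.
Qed.

(** By [gain_riccati_le] at [A *m x], the sample form lies between 0 and [P(A x, A x)], and so does
    its average. The lower bound also uses [Q >= 0]. *)
Lemma bform_riccati_drift P x : psdmx P ->
  - bform P x x <= bform (f P) x x <=
  bform P (A *m x) (A *m x) + bform Q x x - bform P x x.
Proof.
move=> hP; have aP := psd_admissible hP; rewrite riccati_driftE.
have [s sP] := riccati_sample_bounded `|P|.
have sb w : 0 <= bform (riccati_sample P w) x x <= bform P (A *m x) (A *m x).
  rewrite bformZ bform_mulr bform_mull.
  have M0 y : 0 <= bform M y y.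
    by apply: le_trans (M_ge y); rewrite !mulr_ge0 ?sqnorm_ge0 ?ltW.
  have /andP[g0 g1] := gain_riccati_le Rm_gt0 B (H w) (A *m x) hP M0.
  case: (delta w); rewrite ?mul1r ?mul0r ?g0//.
  by rewrite lexx hP.2.
have /andP[] := bform_expectation_mx_bounds Pr (measurable_riccati_sample aP)
  (fun w => sP P w aP (lexx _)) sb.
have := (posdef_psd hQ).2 x.
rewrite !(bformD, bformN) bform_mulr bform_mull.
by move: (bform Q x x) (bform P _ _) (bform P _ _) (bform _ _ _) => *; apply/andP; split; lra.
Qed.

(* As [0 <= g <= A^T P A] for the subtracted expectation [g], an Euler step
   maps the form [P] between [(1 - xi) P] and [(1 - xi) P + xi (A^T P A + Q)]. *)
Lemma euler_riccati_bound (P0 : 'M[R]_S) : psdmx P0 -> exists a b : R,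
  [/\ 0 <= a, 0 <= b & forall xi k, 0 < xi < 1 ->
    psdmx (euler f xi P0 k) /\ `|euler f xi P0 k| <= b * expR (a * (k%:R * xi))].
Proof.
(* [al] and [ka] bound the forms of [A^T A] and [Q]. The 1 in [b] keeps the running bound above 1,
   so that the additive term [Q] can be absorbed multiplicatively. *)
move=> hP0; pose al : R := (S * S)%:R * `|A^T *m A|.
pose ka : R := (S * S)%:R * `|Q|; pose b := 1 + (S * S)%:R * `|P0|.
have a0 : 0 <= al + ka by rewrite addr_ge0// mulr_ge0.
have b1 : 1 <= b by rewrite lerDl mulr_ge0.
have b0 : 0 <= b := le_trans ler01 b1.
exists (al + ka), b; split=> // xi k /andP[xi0 xi1].
suff [hP Pb] : psdmx (euler f xi P0 k) /\ forall x, bform (euler f xi P0 k) x x <=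
    b * expR ((al + ka) * (k%:R * xi)) * bform 1%:M x x.
  by split=> //; apply: psd_norm_le; rewrite ?mulr_ge0 ?expR_ge0.
elim: k => [|k [hP Pb]].
  split=> // x; rewrite mul0r mulr0 expR0 mulr1 /b mulrDl mul1r.
  apply: le_trans (ler_norm _) _; apply: le_trans (bform_norm _ _) _.
  by rewrite lerDr sqnorm_ge0.
set P := euler f xi P0 k in hP Pb *.
have -> : euler f xi P0 k.+1 = P + xi *: f P by [].
have step x := bform_riccati_drift x hP.
split.
  split; first by rewrite linearD linearZ /= riccati_drift_tr ?hP.1.
  move=> x; rewrite bformD bformZ; have /andP[lo _] := step x.
  by have := hP.2 x; nra.
move=> x; rewrite bformD bformZ; have /andP[_ hi] := step x.
set be := b * expR _ in Pb.
have be1 : 1 <= be.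
  rewrite /be -[1]mulr1 ler_pM// -expR0 ler_expR.
  by rewrite !mulr_ge0// ltW.
have x0 := sqnorm_ge0 x.
have Ax : bform P (A *m x) (A *m x) <= be * (al * bform 1%:M x x).
  apply: le_trans (Pb _) _; rewrite ler_wpM2l ?(le_trans ler01)//.
  rewrite -bform_mulr -bform_mull mul1mx.
  by apply: le_trans (ler_norm _) _; exact: bform_norm.
have Qx : bform Q x x <= be * (ka * bform 1%:M x x).
  apply: le_trans (ler_norm _) _; apply: le_trans (bform_norm _ _) _.
  by rewrite ler_peMl// mulr_ge0// mulr_ge0.
(* Discrete Gronwall: one step multiplies the bound by at most [1 + (al + ka) * xi]. *)
have ex : 1 + (al + ka) * xi <= expR ((al + ka) * xi) by exact: expR_ge1Dx.
rewrite -natr1 [_ * xi]mulrDl mul1r mulrDr expRD [b * _]mulrA -/be.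
apply: (@le_trans _ _ (be * (1 + (al + ka) * xi) * bform 1%:M x x)); last first.
  by rewrite ler_wpM2r// ler_wpM2l// (le_trans ler01).
have := Pb x; have := hP.2 x.
move: (bform P x x) (bform P _ _) (bform Q x x) (bform 1%:M x x) hi Ax Qx x0.
move=> p pA q s hi Ax Qx s0 p0 ps.
have : xi * (pA + q - p) <= xi * (be * (al * s) + be * (ka * s)).
  by rewrite ler_pM2l//; lra.
by nra.
Qed.

End riccati.

(** * Error between the Euler interpolation and the flow, by a barrier *)

Section euler_flow.
Context {R : realType} {m n : nat}.
Local Notation V := 'M[R]_(m, n).

Lemma is_derive_coord (X : R -> V) (D : V) (t : R) i j :
  is_derive t 1 X D -> is_derive t 1 (fun s => X s i j) (D i j).
Proof.
move=> [dX XD]; apply: DeriveDef; first exact: (derivable_mxP X t 1).1.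
by rewrite -XD derive_mx// mxE.
Qed.

Lemma continuous_line (y v : V) (t0 : R) : continuous (fun t : R => y + (t - t0) *: v).
Proof.
move=> t; apply: cvgD; first exact: cvg_cst.
by apply: cvgZr_tmp; apply: cvgB; [exact: cvg_id|exact: cvg_cst].
Qed.

(** The solution of [phi' = la (phi + k)] with [phi a = k]; for [k > 0] it starts strictly above the
    error, which is 0 at time [a]. *)
Definition barrier (k a la t : R) : R := k * (2 * expR (la * (t - a)) - 1).

Lemma is_derive_barrier (k a la t : R) :
  is_derive t 1 (barrier k a la) (la * (barrier k a la t + k)).
Proof.
have h : is_derive t (1 : R) (fun s : R => la * (s - a)) la.
  by apply: is_derive_eq; rewrite subr0 /GRing.scale/= mulr1.
rewrite /barrier; apply: is_derive_eq; rewrite /GRing.scale/=; ring.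
Qed.

(** Otherwise let [r] be the infimum of the times where [g >= 0]. Then [g r < 0] by the start value
    or the step hypothesis, and continuity keeps [g] negative just after [r], contradicting the
    infimum. *)
Lemma first_touch (g : R -> R) (s e : R) : {within `[s, e], continuous g} ->
  g s < 0 ->
  (forall t, s < t <= e -> (forall r, s <= r < t -> g r < 0) -> g t < 0) ->
  forall t, s <= t <= e -> g t < 0.
Proof.
move=> gc gs step t1 /andP[st1 t1e]; rewrite ltNge; apply/negP => gt1.
pose Z := [set t | s <= t <= t1 /\ 0 <= g t].
have Z1 : Z t1 by split=> //; rewrite st1 lexx.
have Zlb : lbound Z s by move=> t [/andP[]].
have hZ : has_inf Z by split; [exists t1|exists s].
set r := inf Z.
have sr : s <= r by apply: lb_le_inf => //; exists t1.
have rt1 : r <= t1 by apply: ge_inf => //; exists s.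
have before q : s <= q < r -> g q < 0.
  move=> /andP[sq qr]; rewrite ltNge; apply/negP => gq.
  have : r <= q.
    by apply: ge_inf; [exists s|split=> //; rewrite sq (le_trans (ltW qr) rt1)].
  by rewrite leNgt qr.
have gr : g r < 0.
  move: sr; rewrite le_eqVlt => /predU1P[<-//|sr].
  by apply: step before; rewrite sr (le_trans rt1 t1e).
have : \forall q \near within `[s, e] (nbhs r), g q < 0.
  have ri : `[s, e]%classic r by rewrite /= in_itv/= sr (le_trans rt1 t1e).
  have := gc r; rewrite /continuous_at nbhs_subspace_in// => gcr.
  exact: (cvgr_lt _ gcr).
rewrite near_withinE => -[del /= del0 Hd].
have [q [/andP[sq qt1] gq] qr] := inf_adherent del0 hZ.
have rq : r <= q by apply: ge_inf; [exists s|split=> //; rewrite sq qt1].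
have : g q < 0.
  apply: Hd; last by rewrite /= in_itv/= sq (le_trans qt1 t1e).
  by rewrite /= ler0_norm ?subr_le0// opprB ltrBlDl.
by rewrite ltNge gq.
Qed.

Lemma barrier_nondecreasing (k a la t s : R) : 0 <= k -> 0 <= la -> t <= s ->
  barrier k a la t <= barrier k a la s.
Proof.
move=> k0 la0 ts; rewrite /barrier ler_wpM2l// lerB// ler_wpM2l// ler_expR.
by rewrite ler_wpM2l// lerB.
Qed.

(** At a first touching time the error would have to grow faster than the barrier, while the
    Lipschitz bound makes it grow no faster. The start [s] may lie after the grid point [t0],
    because the initial time of the ODE may fall inside a cell. *)
Lemma cell_step (f : V -> V) (X : R -> V) (y : V) (a t0 s e xi F La rho : R) :
  0 < xi -> 0 <= F -> 0 <= La -> t0 <= s -> e <= t0 + xi -> `|f y| <= F ->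
  (forall x, `|x - y| <= rho -> `|f x - f y| <= La * `|x - y|) ->
  {within `[s, e], continuous X} ->
  (forall t, s < t < e -> is_derive t 1 X (f (X t))) ->
  let phi := barrier (xi * (F + 1)) a (La + 1) in
  phi e + xi * F <= rho ->
  0 <= phi s ->
  `|y + (s - t0) *: f y - X s| < phi s ->
  forall t, s <= t <= e -> `|y + (t - t0) *: f y - X t| < phi t.
Proof.
move=> xi0 F0 La0 t0s e_xi fyF lip Xc Xd phi phi_rho phis es.
have phi_le t t' : t <= t' -> phi t <= phi t'.
  by apply: barrier_nondecreasing; rewrite ?mulr_ge0 ?addr_ge0// ltW.
pose E t := y + (t - t0) *: f y - X t.
pose g t := `|E t| - phi t.
have phid (t : R) : is_derive t 1 phi ((La + 1) * (phi t + xi * (F + 1))).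
  exact: is_derive_barrier.
have phic : continuous phi.
  move=> t; apply: differentiable_continuous; apply/derivable1_diffP.
  by case: (phid t).
have Ec : {within `[s, e], continuous E}.
  apply: within_continuousB => //; apply: continuous_subspaceT.
  exact: continuous_line.
have gc : {within `[s, e], continuous g}.
  apply: within_continuousB; last exact: continuous_subspaceT.
  apply: (within_continuous_comp `[s, e]%classic E (fun z : V => `|z|)) => //.
  by move=> z _; exact: norm_continuous.
suff H : forall t, s <= t <= e -> g t < 0 by move=> t /H; rewrite subr_lt0.
apply: first_touch => //; first by rewrite subr_lt0.
move=> t /andP[st te] before; rewrite ltNge; apply/negP; rewrite subr_ge0 => touch.
(* The barrier is positive, so [E t] is nonzero and its max norm is attained at some entry. *)
have E0 : mx_norm (E t) != 0.
  rewrite -[mx_norm _]/(`|E t|) gt_eqF// (lt_le_trans _ touch)//.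
  by rewrite (lt_le_trans (le_lt_trans (normr_ge0 _) es))// phi_le// ltW.
have [[i j] /= Eij] := mx_norm_neq0 E0.
pose sg : R := Num.sg (E t i j).
(* The norm may fail to be differentiable. This one entry, with its sign at time [t] frozen, is
   differentiable, stays below the norm, and equals it at [t]. *)
pose w r := sg * (y i j + (r - t0) * f y i j - X r i j) - phi r.
have wE r : w r = sg * E r i j - phi r by rewrite /w /E !mxE.
have sg1 : `|sg| <= 1 by rewrite normr_sg lern1; case: eqP.
have sgle r : sg * E r i j <= `|E r|.
  apply: le_trans (ler_norm _) _; rewrite normrM.
  by rewrite (le_trans (ler_wpM2r (normr_ge0 _) sg1))// mul1r coord_le_mx_norm.
have ws : w s < 0.
  by rewrite wE subr_lt0 (le_lt_trans (sgle _)).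
have wt : 0 <= w t.
  by rewrite wE subr_ge0 (le_trans touch)// [leLHS]Eij -normrEsg.
pose dw r := sg * (f y i j - f (X r) i j) - (La + 1) * (phi r + xi * (F + 1)).
have wd (r : R) : r \in `]s, t[ -> is_derive r 1 w (dw r).
  rewrite in_itv/= => /andP[sr rt].
  have /(is_derive_coord i j) Xij : is_derive r 1 X (f (X r)).
    by apply: Xd; rewrite sr (lt_le_trans rt te).
  have lin : is_derive r (1 : R) (fun q => (q - t0) * f y i j) (f y i j).
    by apply: is_derive_eq; rewrite /GRing.scale/=; ring.
  have phir := phid r.
  by apply: is_derive_eq; rewrite /dw /GRing.scale/=; ring.
have wc : {within `[s, t], continuous w}.
  rewrite (_ : w = fun r => sg * E r i j - phi r); last exact/funext.
  apply: (@continuous_subspaceW _ _ `[s, t]%classic `[s, e]%classic).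
    by apply: subset_itvl; rewrite bnd_simp.
  apply: within_continuousB; last exact: continuous_subspaceT.
  apply: (within_continuous_comp `[s, e]%classic E (fun z : V => sg * z i j)) => //.
  by move=> z _; exact: (cvgM (cvg_cst sg) (@coord_continuous _ _ _ i j z)).
(* Since [w s < 0 <= w t], the derivative is positive at some [r] before the touch; there [X r] is
   within [rho] of [y], and the Lipschitz bound forces the opposite sign. *)
have [r] := MVT st wd wc; rewrite in_itv/= => /andP[sr rt] wr.
have : 0 < dw r.
  by rewrite -(pmulr_lgt0 _ (_ : 0 < t - s)) ?subr_gt0// -wr subr_gt0 (lt_le_trans ws).
rewrite ltNge => /negP; apply.
have Er : `|E r| < phi r by rewrite -subr_lt0; apply: before; rewrite (ltW sr) rt.
have Xy : `|X r - y| <= phi r + xi * F.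
  rewrite (_ : X r - y = (r - t0) *: f y - E r); last first.
    by rewrite /E opprB addrCA opprD [_ *: _ + (_ + _)]addrCA subrr addr0.
  rewrite (le_trans (ler_normB _ _))// addrC lerD ?(ltW Er)// normrZ ler_pM//.
  rewrite ger0_norm ?subr_ge0 ?(le_trans t0s (ltW sr))// lerBlDl.
  by rewrite (le_trans _ e_xi)// ltW// (lt_le_trans rt).
have Xrho : `|X r - y| <= rho.
  by rewrite (le_trans Xy)// (le_trans _ phi_rho)// lerD2r phi_le// ltW// (lt_le_trans rt).
have df : sg * (f y i j - f (X r) i j) <= La * (phi r + xi * F).
  apply: le_trans (ler_norm _) _; rewrite normrM.
  rewrite (le_trans (ler_wpM2r (normr_ge0 _) sg1))// mul1r.
  have -> : f y i j - f (X r) i j = (f y - f (X r)) i j by rewrite !mxE.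
  rewrite (le_trans (coord_le_mx_norm _ _ _))// distrC (le_trans (lip _ Xrho))//.
  by rewrite ler_wpM2l.
have phir : 0 <= phi r by rewrite (le_trans phis)// phi_le// ltW.
rewrite /dw subr_le0 (le_trans df)//.
have := mulr_ge0 La0 (ltW xi0); have := mulr_ge0 (ltW xi0) F0.
by move: (phi r) phir xi0 => p p0 x0 xF xLa; nra.
Qed.

Lemma interp_euler (f : V -> V) (P0 : V) (xi : R) k t : 0 < xi ->
  k%:R * xi <= t <= k.+1%:R * xi ->
  interp xi (euler f xi P0) t =
  euler f xi P0 k + (t - k%:R * xi) *: f (euler f xi P0 k).
Proof.
move=> xi0 kt; rewrite (interpE _ xi0 kt) /= addrAC subrr add0r scalerA.
by rewrite mulrAC mulVf ?mul1r// gt_eqF.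
Qed.

Lemma euler_flow_error (f : V -> V) (X : R -> V) (P0 : V) (a L xi F La rho : R) :
  0 < xi -> 0 <= F -> 0 <= La -> 0 <= a ->
  let u := euler f xi P0 in
  (forall k, k%:R * xi <= a + L -> `|f (u k)| <= F) ->
  (forall k x, k%:R * xi <= a + L -> `|x - u k| <= rho ->
    `|f x - f (u k)| <= La * `|x - u k|) ->
  trajectory f a (interp xi u a) X ->
  xi * (F + 1) * (2 * expR ((La + 1) * L)) <= rho ->
  forall t, a <= t <= a + L ->
    `|interp xi u t - X t| <= xi * (F + 1) * (2 * expR ((La + 1) * L)).
Proof.
move=> xi0 F0 La0 a0 u fuF lip [Xa Xc Xd] Krho.
pose phi := barrier (xi * (F + 1)) a (La + 1).
have K0 : 0 < xi * (F + 1) by rewrite mulr_gt0// ltr_wpDl.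
have phi_le t t' : t <= t' -> phi t <= phi t'.
  by apply: barrier_nondecreasing; rewrite ?addr_ge0// ltW.
have phia : 0 < phi a.
  by rewrite /phi /barrier subrr mulr0 expR0 mulr1 pmulr_rgt0//; lra.
(* The [- 1] in the barrier pays for [xi * F], the distance covered by the interpolation within one
   cell. *)
have phiL : phi (a + L) + xi * F <= xi * (F + 1) * (2 * expR ((La + 1) * L)).
  rewrite /phi /barrier addrAC subrr add0r.
  by move: (expR _) => z; nra.
suff H k t : a <= t <= a + L -> t <= k%:R * xi -> `|interp xi u t - X t| < phi t.
  move=> t /andP[at_ tL].
  have tk : t <= (Num.truncn (t / xi)).+1%:R * xi.
    by rewrite -ler_pdivrMr// ltW// truncnS_gt.
  apply: le_trans (ltW (H _ t _ tk)) _; first by rewrite at_.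
  apply: le_trans (phi_le _ _ tL) _; apply: le_trans phiL.
  by rewrite lerDl mulr_ge0// ltW.
have at_a : `|interp xi u a - X a| < phi a by rewrite Xa subrr normr0.
elim: k t => [|k IH] t /andP[at_ tL] tk.
  have -> : t = a; last exact: at_a.
  by apply/eqP; rewrite eq_le at_ andbT (le_trans tk)// mul0r.
have [tk'|kt] := lerP t (k%:R * xi); first by apply: IH => //; rewrite at_.
(* The part of the cell after [a]: it starts at [a] if [a] lies inside the cell, and at the grid
   point otherwise. *)
pose s := Num.max a (k%:R * xi).
have st : s <= t by rewrite ge_max at_ ltW.
have sa : a <= s by rewrite le_max lexx.
have ks : k%:R * xi <= s by rewrite le_max lexx orbT.
have cell r : s <= r <= t ->
    interp xi u r = u k + (r - k%:R * xi) *: f (u k).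
  move=> /andP[sr rt]; rewrite /u (@interp_euler f P0 xi k)//.
  by rewrite (le_trans ks sr) (le_trans rt tk).
rewrite cell ?lexx ?st//.
have kL : k%:R * xi <= a + L by rewrite (le_trans (ltW kt) tL).
apply: (@cell_step f X (u k) a (k%:R * xi) s t xi F La rho) => //.
- by rewrite (le_trans tk)// -[in leLHS]natr1 mulrDl mul1r.
- exact: fuF.
- by move=> x; exact: lip.
- apply: continuous_subspaceW Xc => r /=; rewrite !in_itv/= => /andP[sr _].
  by rewrite (le_trans sa sr).
- by move=> r /andP[sr _]; apply: Xd; rewrite (le_lt_trans sa sr).
- by rewrite (le_trans _ Krho)// (le_trans _ phiL)// lerD2r phi_le.
- by rewrite (le_trans (ltW phia))// phi_le.
- rewrite -cell ?lexx ?st//.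
  rewrite /s; case: (lerP (k%:R * xi) a) => [//|ak].
  by apply: IH => //; rewrite (ltW ak).
- by rewrite st lexx.
Qed.

End euler_flow.

(** * Choice of constants independent of [xi], and the final estimate *)

Theorem lemma6 (R : realType) (d : measure_display) (T : measurableType d)
    (Pr : probability T R) (S Nr Nt : nat)
    (A : 'M[R]_S) (B : 'M[R]_(S, Nr)) (Q : 'M[R]_S)
    (Rm : 'M[R]_Nt) (M : 'M[R]_Nr)
    (hQ : posdefmx Q) (hR : posdefmx Rm) (hM : posdefmx M)
    (delta : nat -> {RV Pr >-> bool})
    (H : nat -> {RV Pr >-> borel_matrix R Nr Nt})
    (hH_law : forall k i j,
       has_law Pr (fun w => (H k w : 'M[R]_(Nr, Nt)) i j) (normal_prob 0 1))
    (hH_indep : forall k,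
       mutually_independent Pr
         (fun (ij : 'I_Nr * 'I_Nt) w =>
            (H k w : 'M[R]_(Nr, Nt)) ij.1 ij.2))
    (hdH_indep : forall k, independent Pr (delta k) (H k))
    (hpair_indep :
       mutually_independent Pr (fun (k : nat) w => (delta k w, H k w)))
    (hpair_law : forall k k',
       same_law Pr (fun w => (delta k w, H k w))
                   (fun w => (delta k' w, H k' w)))
    (k0 : nat) (P0 : 'M[R]_S) (hP0 : posdefmx P0)
    (l L : R) (hl : 0 < l) (hL : 0 < L) :
  let f := riccati_drift Pr A B Q Rm M (delta k0) (H k0) in
  let Pbar := fun xi : R => interp xi (euler f xi P0) in
  forall Pl : R -> R -> 'M[R]_S,
    (forall xi : R, 0 < xi < 1 -> trajectory f l (Pbar xi l) (Pl xi)) ->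
    exists C : R, \forall xi \near 0^'+,
      (ereal_sup [set (spectral_norm (Pbar xi (l + t) - Pl xi (l + t)))%:E
                 | t in `[0%R, L]] <= (C * xi)%:E)%E.
Proof.
move=> f Pbar Pl hPl.
have [m m0 hm] := posdef_lower_bound hM.
pose c := m / 2; have c0 : 0 < c by rewrite divr_gt0.
have Mc y : 2 * c * bform 1%:M y y <= bform M y y.
  by rewrite /c mulrCA mulfV// mulr1.
have mdelta : measurable_fun setT (delta k0 : T -> bool) by exact: measurable_funPT.
have mH : measurable_mx (H k0 : T -> 'M[R]_(Nr, Nt)).
  by apply: measurable_borel_matrix; exact: measurable_funPT.
have [a [b [a0 b0 hE]]] :=
  euler_riccati_bound Pr A B hQ hR c0 hM.1 Mc mdelta mH (posdef_psd hP0).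
pose be := b * expR (a * (l + L)).
have [r r0 hr] := near_psd_admissible B c0 Mc.
have [F0 hF] := riccati_drift_bounded Pr A B Q M hR c0 mdelta mH be.
(* Iterates have norm at most [be], and they are compared with points at distance at most
   [rho <= 1]. *)
have [La0 hLa] := riccati_drift_lipschitz Pr A B Q M hR c0 mdelta mH (be + 1).
pose F := `|F0|; pose La := `|La0|; pose rho := Num.min r 1.
have rho0 : 0 < rho by rewrite lt_min r0 ltr01.
pose K := (F + 1) * (2 * expR ((La + 1) * L)).
have K0 : 0 < K.
  by apply: mulr_gt0; [rewrite ltr_wpDl// /F|rewrite mulr_gt0// expR_gt0].
(* The factor [S * S] converts the max-norm bound [xi * K] to the spectral norm. *)
exists ((S * S)%:R * K).
near=> xi.
have xi01 : 0 < xi < 1.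
  apply/andP; split; near: xi; first exact: nbhs_right_gt.
  exact: nbhs_right_lt.
have xi0 : 0 < xi by case/andP: xi01.
(* For such [xi] the barrier keeps the trajectory in the neighbourhood where the Lipschitz bound
   holds. *)
have xiK : xi * K <= rho.
  rewrite -ler_pdivlMr//; near: xi; apply: nbhs_right_ltW.
  by rewrite divr_gt0.
pose u := euler f xi P0.
have hu k : k%:R * xi <= l + L -> psdmx (u k) /\ `|u k| <= be.
  move=> kl; have [hP Pb] := hE xi k xi01; split=> //; apply: le_trans Pb _.
  by rewrite ler_wpM2l// ler_expR ler_wpM2l.
have psd_adm P : psdmx P -> admissible B M c P by exact: psd_admissible.
have main t : l <= t <= l + L -> `|Pbar xi t - Pl xi t| <= xi * K.
  rewrite /K mulrA; apply: (@euler_flow_error _ _ _ f (Pl xi) P0 l L xi F La rho) => //.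
  - exact: normr_ge0.
  - exact: normr_ge0.
  - exact: ltW.
  - move=> k /hu[hP Pb]; apply: le_trans (ler_norm F0).
    by apply: hF => //; exact: psd_adm.
  - move=> k x /hu[hP Pb] xr.
    have xr1 : `|x - u k| <= 1 by rewrite (le_trans xr)// ge_min lexx orbT.
    apply: (@le_trans _ _ (La0 * `|x - u k|)); last by rewrite ler_wpM2r// ler_norm.
    apply: hLa => //; [|exact: psd_adm| |by rewrite (le_trans Pb)// lerDl].
      by apply: hr hP _; rewrite (le_trans xr)// ge_min lexx.
    by rewrite -[x](subrK (u k)) (le_trans (ler_normD _ _))// addrC lerD.
  - exact: hPl.
  - by rewrite -mulrA.
apply: ge_ereal_sup => y [t /=]; rewrite in_itv/= => /andP[t0 tL] <-.
rewrite lee_fin (le_trans (spectral_norm_le _))// -mulrA ler_wpM2l// [K * _]mulrC.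
by apply: main; rewrite lerDl t0 lerD2l.
Unshelve. all: by end_near.
Qed.
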